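(* Let $\varphi\in S(\mathbb{D})$ with $\varphi\notin \mathrm{Aut}(\mathbb{D})$, and suppose that $\varphi$ has no fixed point in $\mathbb{D}$. Suppose further that the composition operator $C_\varphi$ is bounded on the little Bloch space $\mathcal{B}_0$. Then $C_\varphi$ is not hypercyclic on $\mathcal{B}_0$.
   Context: $\mathbb{D}=\{z\in\mathbb{C}:|z|<1\}$, $H(\mathbb{D})$ is the space of holomorphic functions on $\mathbb{D}$, and $S(\mathbb{D})$ is the set of all holomorphic self-maps of $\mathbb{D}$. $\mathrm{Aut}(\mathbb{D})$ is the set of one-to-one holomorphic maps of $\mathbb{D}$ onto itself. For $\varphi\in S(\mathbb{D})$, $C_\varphi f=f\circ\varphi$ for $f\in H(\mathbb{D})$. The Bloch space is $\mathcal{B}=\{f\in H(\mathbb{D}):\|f\|_{\mathcal{B}}=\sup_{z\in\mathbb{D}}(1-|z|^2)|f'(z)|<\infty\}$; the little Bloch space is $\mathcal{B}_0=\{f\in\mathcal{B}:\lim_{|z|\to1}(1-|z|^2)|f'(z)|=0\}$. Both carry the complete norm $\|f\|_{Bloch}=|f(0)|+\|f\|_{\mathcal{B}}$. ''$C_\varphi$ is bounded on $\mathcal{B}_0$'' means that $C_\varphi$ is a bounded linear operator from $\mathcal{B}_0$ to $\mathcal{B}_0$. A continuous linear operator $T$ on a separable infinite-dimensional Banach space $X$ is hypercyclic if there is $f\in X$ whose orbit $\{T^nf:n=0,1,2,\dots\}$ is dense in $X$. *)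

(* Defs.v *)
From Stdlib Require Import Reals Lra FunctionalExtensionality ProofIrrelevance.
From Coquelicot Require Import Coquelicot.

Open Scope R_scope.

(** A function on the unit disc is represented by a total function [C -> C]
    whose values off the disc are irrelevant.  The disc being open, so are they
    for the derivative at a point of the disc. *)

Definition in_disc (z : C) : Prop := Cmod z < 1.

Definition holomorphic_disc (f : C -> C) : Prop :=
  forall z : C, in_disc z ->
    ex_derive (K := C_AbsRing) (V := C_NormedModule) f z.

Definition self_map_disc (phi : C -> C) : Prop :=
  holomorphic_disc phi /\ forall z : C, in_disc z -> in_disc (phi z).

Definition automorphism_disc (phi : C -> C) : Prop :=
  self_map_disc phi /\
  (forall z w : C, in_disc z -> in_disc w -> phi z = phi w -> z = w) /\
  (forall w : C, in_disc w -> exists z : C, in_disc z /\ phi z = w).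

(** [C_derive] is computed along the real direction; it is the complex derivative
    wherever [f] is complex differentiable, hence on the disc for the [f] used. *)
Definition bloch_weight (f : C -> C) (z : C) : R :=
  (1 - Cmod z ^ 2) * Cmod (C_derive f z).

Definition bloch_seminorm (f : C -> C) : Rbar :=
  Lub_Rbar (fun r : R => exists z : C, in_disc z /\ r = bloch_weight f z).

Definition in_bloch (f : C -> C) : Prop :=
  holomorphic_disc f /\ Rbar_lt (bloch_seminorm f) p_infty.

Definition in_little_bloch (f : C -> C) : Prop :=
  in_bloch f /\
  forall eps : R, 0 < eps ->
    exists r : R, r < 1 /\
      forall z : C, r < Cmod z < 1 -> Rabs (bloch_weight f z) < eps.

(** The field [lb_off] picks one representative for each function on the disc,
    so that Leibniz equality on [little_bloch] is equality on the disc. *)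
Record little_bloch : Type := LittleBloch {
  lb_fun :> C -> C;
  lb_in : in_little_bloch lb_fun;
  lb_off : forall z : C, ~ in_disc z -> lb_fun z = RtoC 0
}.

(** Real-valued, since [bloch_seminorm f] is finite. *)
Definition bloch_norm (f : little_bloch) : R :=
  Cmod (f (RtoC 0)) + real (bloch_seminorm f).

Lemma lb_eq (f g : little_bloch) : (forall z, in_disc z -> f z = g z) -> f = g.
Proof.
  destruct f as [f Hf f0], g as [g Hg g0]; simpl; intros H.
  assert (E : f = g).
  { apply functional_extensionality; intros z.
    destruct (Rlt_dec (Cmod z) 1) as [h|h]; [now apply H|].
    now rewrite f0, g0. }
  subst g; f_equal; apply proof_irrelevance.
Qed.

Lemma bloch_weight_ge0 f z : in_disc z -> 0 <= bloch_weight f z.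
Proof.
  intros Hz; unfold bloch_weight, in_disc in *.
  apply Rmult_le_pos; [|apply Cmod_ge_0].
  generalize (Cmod_ge_0 z); nra.
Qed.

Lemma in_disc0 : in_disc (RtoC 0).
Proof. unfold in_disc; rewrite Cmod_0; lra. Qed.

Lemma bloch_seminorm_finite f : in_bloch f ->
  bloch_seminorm f = Finite (real (bloch_seminorm f)).
Proof.
  intros [_ H].
  destruct (Lub_Rbar_correct
    (fun r : R => exists z, in_disc z /\ r = bloch_weight f z)) as [ub _].
  fold (bloch_seminorm f) in ub.
  specialize (ub (bloch_weight f (RtoC 0))
    (ex_intro _ _ (conj in_disc0 eq_refl))).
  destruct (bloch_seminorm f); simpl in *; easy.
Qed.

Lemma bloch_seminorm_ub f z : in_bloch f -> in_disc z ->
  bloch_weight f z <= real (bloch_seminorm f).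
Proof.
  intros Hf Hz.
  destruct (Lub_Rbar_correct
    (fun r : R => exists z, in_disc z /\ r = bloch_weight f z)) as [ub _].
  fold (bloch_seminorm f) in ub.
  specialize (ub (bloch_weight f z) (ex_intro _ _ (conj Hz eq_refl))).
  now rewrite (bloch_seminorm_finite f Hf) in ub.
Qed.

Lemma bloch_seminorm_le f (M : R) :
  (forall z, in_disc z -> bloch_weight f z <= M) ->
  Rbar_le (bloch_seminorm f) M.
Proof.
  intros H.
  destruct (Lub_Rbar_correct
    (fun r : R => exists z, in_disc z /\ r = bloch_weight f z)) as [_ lub].
  apply lub; intros x [z [Hz ->]]; now apply H.
Qed.

Lemma in_bloch_bound f (M : R) : holomorphic_disc f ->
  (forall z, in_disc z -> bloch_weight f z <= M) ->
  in_bloch f /\ real (bloch_seminorm f) <= M.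
Proof.
  intros Hh H; generalize (bloch_seminorm_le f M H); intros L.
  assert (B : in_bloch f).
  { split; [easy|]; destruct (bloch_seminorm f); simpl in *; easy. }
  split; [easy|]; now rewrite (bloch_seminorm_finite f B) in L.
Qed.

Lemma bloch_seminorm_ge0 f : in_bloch f -> 0 <= real (bloch_seminorm f).
Proof.
  intros Hf; apply Rle_trans with (bloch_weight f (RtoC 0)).
  - apply bloch_weight_ge0, in_disc0.
  - apply bloch_seminorm_ub; [easy | apply in_disc0].
Qed.

Lemma C_derive_add f g z :
  ex_derive (K := C_AbsRing) (V := C_NormedModule) f z ->
  ex_derive (K := C_AbsRing) (V := C_NormedModule) g z ->
  is_derive (K := C_AbsRing) (V := C_NormedModule)
    (fun w : C => Cplus (f w) (g w)) z (Cplus (C_derive f z) (C_derive g z)).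
Proof.
  intros Hf Hg.
  apply (is_derive_plus (K := C_AbsRing) (V := C_NormedModule) f g);
    apply C_derive_correct; easy.
Qed.

Lemma C_derive_scale k f z :
  ex_derive (K := C_AbsRing) (V := C_NormedModule) f z ->
  is_derive (K := C_AbsRing) (V := C_NormedModule)
    (fun w : C => Cmult k (f w)) z (Cmult k (C_derive f z)).
Proof.
  intros Hf; generalize (C_derive_correct f z (RtoC 0) Hf); intros D.
  generalize (filterdiff_scal_r_fct (K := C_AbsRing) (U := AbsRing_NormedModule C_AbsRing) (V := C_NormedModule)
    k f _ (fun a b => Cmult_comm a b) D).
  intros E; split.
  - apply (is_linear_scal_l (K := C_AbsRing) (V := C_NormedModule)).
  - destruct E as [_ E]; intros x Hx eps; generalize (E x Hx eps).
    apply filter_imp; intros y Hy.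
    refine (eq_ind _ (fun v : C_NormedModule => norm (minus (minus
      (scal k (f y)) (scal k (f x))) v) <= eps * norm (minus y x)) Hy _ _).
    change (Cmult k (Cmult (minus y x) (C_derive f z))
      = Cmult (minus y x) (Cmult k (C_derive f z))); ring.
Qed.

Lemma bloch_weight_add f g z : in_disc z ->
  holomorphic_disc f -> holomorphic_disc g ->
  bloch_weight (fun w : C => Cplus (f w) (g w)) z
    <= bloch_weight f z + bloch_weight g z.
Proof.
  intros Hz Hf Hg; unfold bloch_weight.
  rewrite (is_C_derive_unique _ _ _ (C_derive_add f g z (Hf z Hz) (Hg z Hz))).
  rewrite <- Rmult_plus_distr_l; apply Rmult_le_compat_l; [|apply Cmod_triangle].
  unfold in_disc in Hz; generalize (Cmod_ge_0 z); nra.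
Qed.

Lemma bloch_weight_scale k f z : in_disc z -> holomorphic_disc f ->
  bloch_weight (fun w : C => Cmult k (f w)) z = Cmod k * bloch_weight f z.
Proof.
  intros Hz Hf; unfold bloch_weight.
  rewrite (is_C_derive_unique _ _ _ (C_derive_scale k f z (Hf z Hz))).
  rewrite Cmod_mult; ring.
Qed.

Lemma holomorphic_add f g : holomorphic_disc f -> holomorphic_disc g ->
  holomorphic_disc (fun w : C => Cplus (f w) (g w)).
Proof.
  intros Hf Hg z Hz; eexists; apply C_derive_add; [now apply Hf | now apply Hg].
Qed.

Lemma holomorphic_scale k f : holomorphic_disc f ->
  holomorphic_disc (fun w : C => Cmult k (f w)).
Proof.
  intros Hf z Hz; eexists; apply C_derive_scale; now apply Hf.
Qed.

Lemma bloch_add f g : in_bloch f -> in_bloch g ->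
  in_bloch (fun w : C => Cplus (f w) (g w)) /\
  real (bloch_seminorm (fun w : C => Cplus (f w) (g w)))
    <= real (bloch_seminorm f) + real (bloch_seminorm g).
Proof.
  intros Bf Bg.
  apply in_bloch_bound; [now apply holomorphic_add; [apply Bf | apply Bg]|].
  intros z Hz.
  eapply Rle_trans; [apply bloch_weight_add; [easy | apply Bf | apply Bg]|].
  apply Rplus_le_compat; now apply bloch_seminorm_ub.
Qed.

Lemma bloch_scale k f : in_bloch f ->
  in_bloch (fun w : C => Cmult k (f w)) /\
  real (bloch_seminorm (fun w : C => Cmult k (f w)))
    <= Cmod k * real (bloch_seminorm f).
Proof.
  intros Bf; apply in_bloch_bound; [apply holomorphic_scale, Bf|].
  intros z Hz; rewrite bloch_weight_scale; [|easy|apply Bf].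
  apply Rmult_le_compat_l; [apply Cmod_ge_0 | now apply bloch_seminorm_ub].
Qed.

Lemma little_bloch_add f g : in_little_bloch f -> in_little_bloch g ->
  in_little_bloch (fun w : C => Cplus (f w) (g w)).
Proof.
  intros [Bf Lf] [Bg Lg]; split; [now apply bloch_add|].
  intros eps He.
  destruct (Lf (eps / 2)) as [r [Hr Pr]]; [lra|].
  destruct (Lg (eps / 2)) as [s [Hs Ps]]; [lra|].
  exists (Rmax r s); split; [now apply Rmax_lub_lt|].
  intros z [Hz1 Hz2].
  specialize (Pr z (conj (Rle_lt_trans _ _ _ (Rmax_l r s) Hz1) Hz2)).
  specialize (Ps z (conj (Rle_lt_trans _ _ _ (Rmax_r r s) Hz1) Hz2)).
  generalize (bloch_weight_add f g z Hz2 (proj1 Bf) (proj1 Bg)).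
  generalize (bloch_weight_ge0 (fun w : C => Cplus (f w) (g w)) z Hz2).
  intros H1 H2; rewrite Rabs_pos_eq; [|easy].
  generalize (Rle_abs (bloch_weight f z)) (Rle_abs (bloch_weight g z)); lra.
Qed.

Lemma little_bloch_scale k f : in_little_bloch f ->
  in_little_bloch (fun w : C => Cmult k (f w)).
Proof.
  intros [Bf Lf]; split; [now apply bloch_scale|].
  intros eps He; generalize (Cmod_ge_0 k); intros Hk.
  destruct (Lf (eps / (Cmod k + 1))) as [r [Hr Pr]].
  { apply Rdiv_lt_0_compat; lra. }
  exists r; split; [easy|]; intros z Hz; specialize (Pr z Hz).
  rewrite bloch_weight_scale; [|apply Hz|apply Bf].
  rewrite Rabs_mult, (Rabs_pos_eq (Cmod k)); [|easy].
  apply Rlt_div_r in Pr; [|lra].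
  generalize (Rabs_pos (bloch_weight f z)); nra.
Qed.

Lemma is_derive_C_const (c z : C) :
  is_derive (K := C_AbsRing) (V := C_NormedModule) (fun _ : C => c) z (RtoC 0).
Proof. exact (is_derive_const (K := C_AbsRing) (V := C_NormedModule) c z). Qed.

Lemma bloch_weight_0 z : bloch_weight (fun _ : C => RtoC 0) z = 0.
Proof.
  unfold bloch_weight.
  rewrite (is_C_derive_unique _ _ _ (is_derive_C_const (RtoC 0) z)), Cmod_0; ring.
Qed.

Lemma little_bloch_0 : in_little_bloch (fun _ : C => RtoC 0).
Proof.
  split.
  - apply (in_bloch_bound _ 0).
    + intros z _; eexists; apply is_derive_C_const.
    + intros z _; rewrite bloch_weight_0; lra.
  - intros eps He; exists 0; split; [lra|]; intros z _.
    now rewrite bloch_weight_0, Rabs_R0.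
Qed.

Definition lb_zero : little_bloch :=
  LittleBloch (fun _ : C => RtoC 0) little_bloch_0 (fun _ _ => eq_refl).

Program Definition lb_plus (f g : little_bloch) : little_bloch :=
  LittleBloch (fun z => Cplus (f z) (g z))
    (little_bloch_add f g (lb_in f) (lb_in g)) _.
Next Obligation. rewrite (lb_off f), (lb_off g); [ring | easy | easy]. Qed.

Program Definition lb_scal (k : C) (f : little_bloch) : little_bloch :=
  LittleBloch (fun z => Cmult k (f z)) (little_bloch_scale k f (lb_in f)) _.
Next Obligation. rewrite (lb_off f); [ring | easy]. Qed.

Definition lb_opp (f : little_bloch) : little_bloch :=
  lb_scal (Copp (RtoC 1)) f.

Lemma lb_plus_comm f g : lb_plus f g = lb_plus g f.
Proof. apply lb_eq; intros z _; simpl; ring. Qed.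
Lemma lb_plus_assoc f g h : lb_plus f (lb_plus g h) = lb_plus (lb_plus f g) h.
Proof. apply lb_eq; intros z _; simpl; ring. Qed.
Lemma lb_plus_0 f : lb_plus f lb_zero = f.
Proof. apply lb_eq; intros z _; simpl; ring. Qed.
Lemma lb_plus_opp f : lb_plus f (lb_opp f) = lb_zero.
Proof. apply lb_eq; intros z _; simpl; ring. Qed.

Definition lb_AbelianMonoid_mixin :=
  AbelianMonoid.Mixin little_bloch lb_plus lb_zero
    lb_plus_comm lb_plus_assoc lb_plus_0.
Canonical lb_AbelianMonoid :=
  AbelianMonoid.Pack little_bloch lb_AbelianMonoid_mixin little_bloch.

Definition lb_AbelianGroup_mixin :=
  AbelianGroup.Mixin lb_AbelianMonoid lb_opp lb_plus_opp.
Canonical lb_AbelianGroup :=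
  AbelianGroup.Pack little_bloch
    (AbelianGroup.Class _ _ lb_AbelianGroup_mixin) little_bloch.

Lemma lb_scal_assoc (k l : C_Ring) (f : lb_AbelianGroup) :
  lb_scal k (lb_scal l f) = lb_scal (mult k l) f.
Proof. apply lb_eq; intros z _; simpl; unfold mult; simpl; ring. Qed.
Lemma lb_scal_one (f : lb_AbelianGroup) : lb_scal (one (K := C_Ring)) f = f.
Proof. apply lb_eq; intros z _; simpl; unfold one; simpl; ring. Qed.
Lemma lb_scal_plus_r (k : C_Ring) (f g : lb_AbelianGroup) :
  lb_scal k (plus f g) = plus (lb_scal k f) (lb_scal k g).
Proof. apply lb_eq; intros z _; simpl; ring. Qed.
Lemma lb_scal_plus_l (k l : C_Ring) (f : lb_AbelianGroup) :
  lb_scal (plus k l) f = plus (lb_scal k f) (lb_scal l f).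
Proof. apply lb_eq; intros z _; simpl; unfold plus; simpl; ring. Qed.

Definition lb_ModuleSpace_mixin :=
  ModuleSpace.Mixin C_Ring lb_AbelianGroup lb_scal
    lb_scal_assoc lb_scal_one lb_scal_plus_r lb_scal_plus_l.
Canonical lb_ModuleSpace :=
  ModuleSpace.Pack C_Ring little_bloch
    (ModuleSpace.Class _ _ _ lb_ModuleSpace_mixin) little_bloch.

Lemma bloch_norm_triangle (f g : little_bloch) :
  bloch_norm (lb_plus f g) <= bloch_norm f + bloch_norm g.
Proof.
  unfold bloch_norm; simpl.
  generalize (Cmod_triangle (f (RtoC 0)) (g (RtoC 0))).
  generalize (proj2 (bloch_add f g (proj1 (lb_in f)) (proj1 (lb_in g)))); lra.
Qed.

Lemma bloch_norm_scal k (f : little_bloch) :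
  bloch_norm (lb_scal k f) <= Cmod k * bloch_norm f.
Proof.
  unfold bloch_norm; simpl; rewrite Cmod_mult.
  generalize (proj2 (bloch_scale k f (proj1 (lb_in f)))); lra.
Qed.

Lemma bloch_norm_opp (f : little_bloch) : bloch_norm (lb_opp f) <= bloch_norm f.
Proof.
  eapply Rle_trans; [apply bloch_norm_scal|].
  rewrite Cmod_opp, Cmod_1; lra.
Qed.

Lemma bloch_norm_0 : bloch_norm lb_zero = 0.
Proof.
  unfold bloch_norm; simpl; rewrite Cmod_0.
  destruct (in_bloch_bound (fun _ : C => RtoC 0) 0) as [B H].
  - apply (lb_in lb_zero).
  - intros z _; rewrite bloch_weight_0; lra.
  - generalize (bloch_seminorm_ge0 _ B); lra.
Qed.

Definition bloch_ball (f : little_bloch) (eps : R) (g : little_bloch) : Prop :=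
  bloch_norm (minus g f) < eps.

Lemma bloch_ball_center (f : little_bloch) (eps : posreal) :
  bloch_ball f eps f.
Proof.
  unfold bloch_ball; rewrite minus_eq_zero.
  change (bloch_norm lb_zero < eps); rewrite bloch_norm_0; apply cond_pos.
Qed.

Lemma bloch_ball_sym (f g : little_bloch) (eps : R) :
  bloch_ball f eps g -> bloch_ball g eps f.
Proof.
  unfold bloch_ball; intros H.
  rewrite <- (opp_minus g f).
  eapply Rle_lt_trans; [apply bloch_norm_opp | exact H].
Qed.

Lemma bloch_ball_triangle (f g h : little_bloch) (e1 e2 : R) :
  bloch_ball f e1 g -> bloch_ball g e2 h -> bloch_ball f (e1 + e2) h.
Proof.
  unfold bloch_ball; intros H1 H2.
  rewrite (minus_trans g h f).
  eapply Rle_lt_trans; [apply bloch_norm_triangle|].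
  rewrite Rplus_comm; now apply Rplus_lt_compat.
Qed.

Definition lb_UniformSpace_mixin :=
  UniformSpace.Mixin little_bloch lb_zero bloch_ball
    bloch_ball_center bloch_ball_sym bloch_ball_triangle.
Canonical lb_UniformSpace :=
  UniformSpace.Pack little_bloch lb_UniformSpace_mixin little_bloch.

Canonical lb_NormedModuleAux :=
  NormedModuleAux.Pack C_AbsRing little_bloch
    (NormedModuleAux.Class C_AbsRing little_bloch
      (ModuleSpace.class C_Ring lb_ModuleSpace) lb_UniformSpace_mixin)
    little_bloch.

Lemma Rabs_fst_le (z : C) : Rabs (fst z) <= Cmod z.
Proof. eapply Rle_trans; [apply Rmax_l | apply Rmax_Cmod]. Qed.
Lemma Rabs_snd_le (z : C) : Rabs (snd z) <= Cmod z.
Proof. eapply Rle_trans; [apply Rmax_r | apply Rmax_Cmod]. Qed.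

Lemma zero_derive_const (f : C -> C) (p : C -> R) :
  (forall z w, Rabs (p z - p w) <= Cmod (Cminus z w)) ->
  holomorphic_disc f -> (forall z, in_disc z -> C_derive f z = RtoC 0) ->
  forall z, in_disc z -> p (f z) = p (f (RtoC 0)).
Proof.
  intros Hp Hf Hd z Hz.
  set (h := fun t : R => p (f (Cmult (RtoC t) z))).
  assert (Dh : forall t, 0 <= t <= 1 -> is_derive h t 0).
  { intros t Ht.
    assert (Htz : in_disc (Cmult (RtoC t) z)).
    { unfold in_disc in *; rewrite Cmod_mult, Cmod_R, Rabs_pos_eq; [|easy].
      generalize (Cmod_ge_0 z); nra. }
    generalize (C_derive_correct f _ (RtoC 0) (Hf _ Htz)); rewrite (Hd _ Htz).
    intros [_ D]; specialize (D _ (fun P H => H)).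
    split; [apply (is_linear_scal_l (K := R_AbsRing) (V := R_NormedModule))|].
    intros x Hx.
    apply (is_filter_lim_locally_unique (K := R_AbsRing)
      (V := R_NormedModule) t x) in Hx; subst x.
    intros eps.
    assert (He : 0 < eps / (Cmod z + 1)).
    { apply Rdiv_lt_0_compat; [apply cond_pos|].
      generalize (Cmod_ge_0 z); lra. }
    destruct (D (mkposreal _ He)) as [d Pd].
    assert (Hd' : 0 < d / (Cmod z + 1)).
    { apply Rdiv_lt_0_compat; [apply cond_pos|].
      generalize (Cmod_ge_0 z); lra. }
    exists (mkposreal _ Hd'); intros s Hs.
    change (Rabs (s - t) < d / (Cmod z + 1)) in Hs.
    assert (Hst : Cmod (Cminus (Cmult (RtoC s) z) (Cmult (RtoC t) z))
                  = Rabs (s - t) * Cmod z).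
    { rewrite <- Cmod_R, <- Cmod_mult; f_equal.
      rewrite RtoC_minus; ring. }
    generalize (Cmod_ge_0 z) (Rabs_pos (s - t)); intros Hz0 Hs0.
    specialize (Pd (Cmult (RtoC s) z)).
    assert (Pd' : Cmod (Cminus (f (Cmult (RtoC s) z)) (f (Cmult (RtoC t) z)))
      <= eps / (Cmod z + 1) * (Rabs (s - t) * Cmod z)).
    { rewrite <- Hst.
      replace (Cminus (f (Cmult (RtoC s) z)) (f (Cmult (RtoC t) z))) with
        (minus (minus (f (Cmult (RtoC s) z)) (f (Cmult (RtoC t) z)))
          (scal (K := C_AbsRing) (V := C_NormedModule)
            (minus (Cmult (RtoC s) z) (Cmult (RtoC t) z)) (RtoC 0))).
      - apply Pd.
        change (Cmod (Cminus (Cmult (RtoC s) z) (Cmult (RtoC t) z)) < d).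
        rewrite Hst; apply Rlt_div_r in Hs; [nra | lra].
      - unfold minus, plus, opp, scal; simpl; unfold mult; simpl; ring. }
    change (Rabs (h s - h t + - ((s - t) * 0)) <= eps * Rabs (s - t)).
    rewrite Rmult_0_r, Ropp_0, Rplus_0_r.
    eapply Rle_trans; [apply Hp|]; eapply Rle_trans; [exact Pd'|].
    replace (eps / (Cmod z + 1) * (Rabs (s - t) * Cmod z)) with
      (eps * Rabs (s - t) * (Cmod z / (Cmod z + 1))) by (field; lra).
    rewrite <- (Rmult_1_r (eps * Rabs (s - t))) at 2.
    apply Rmult_le_compat_l.
    - apply Rmult_le_pos; [apply Rlt_le, cond_pos | easy].
    - apply Rle_div_l; lra. }
  destruct (MVT_gen h 0 1 (fun _ => 0)) as [c [_ Hc]].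
  - intros x Hx; rewrite Rmin_left, Rmax_right in Hx; try lra; apply Dh; lra.
  - intros x Hx; rewrite Rmin_left, Rmax_right in Hx; try lra.
    apply continuity_pt_filterlim, (ex_derive_continuous h x).
    exists 0; apply Dh; lra.
  - unfold h in Hc; rewrite Cmult_1_l, Cmult_0_l in Hc; lra.
Qed.

Lemma bloch_norm_eq0 (f : little_bloch) : bloch_norm f = 0 -> f = lb_zero.
Proof.
  intros H; unfold bloch_norm in H.
  assert (B := proj1 (lb_in f)).
  generalize (bloch_seminorm_ge0 f B) (Cmod_ge_0 (f (RtoC 0))); intros H1 H2.
  assert (F0 : f (RtoC 0) = RtoC 0) by (apply Cmod_eq_0; lra).
  assert (D : forall z, in_disc z -> C_derive f z = RtoC 0).
  { intros z Hz; apply Cmod_eq_0.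
    generalize (bloch_seminorm_ub f z B Hz) (bloch_weight_ge0 f z Hz).
    unfold bloch_weight, in_disc in *.
    generalize (Cmod_ge_0 z) (Cmod_ge_0 (C_derive f z)); intros.
    destruct (Rmult_integral (1 - Cmod z ^ 2) (Cmod (C_derive f z))); nra. }
  apply lb_eq; intros z Hz; simpl.
  apply injective_projections.
  - rewrite (zero_derive_const f fst) by
      (try easy; try apply B; intros u v; apply (Rabs_fst_le (Cminus u v))).
    now rewrite F0.
  - rewrite (zero_derive_const f snd) by
      (try easy; try apply B; intros u v; apply (Rabs_snd_le (Cminus u v))).
    now rewrite F0.
Qed.

Definition lb_NormedModule_mixin :=
  NormedModule.Mixin C_AbsRing lb_NormedModuleAux bloch_norm 1
    bloch_norm_triangle bloch_norm_scal
    (fun f g eps H => H)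
    (fun f g eps H => eq_ind_r (fun e => bloch_norm (minus g f) < e)
                        H (Rmult_1_l eps))
    bloch_norm_eq0.
Canonical lb_NormedModule :=
  NormedModule.Pack C_AbsRing little_bloch
    (NormedModule.Class C_AbsRing little_bloch
      (NormedModuleAux.class C_AbsRing lb_NormedModuleAux)
      lb_NormedModule_mixin) little_bloch.

Definition dense {X : UniformSpace} (S : X -> Prop) : Prop :=
  forall U : X -> Prop, open U -> (exists x : X, U x) ->
    exists x : X, U x /\ S x.

(** Only applied to bounded linear [T]. *)
Definition hypercyclic {X : UniformSpace} (T : X -> X) : Prop :=
  exists x : X, dense (fun y : X => exists n : nat, y = Nat.iter n T x).

(** Such a [T] exists exactly when [f o phi] is in the little Bloch space for
    every [f] there; by [lb_off] it is then unique. *)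
Definition is_composition_operator (phi : C -> C)
    (T : little_bloch -> little_bloch) : Prop :=
  forall (f : little_bloch) (z : C), in_disc z -> T f z = f (phi z).

(* Main.v *)
Require Import Defs.
From Stdlib Require Import Reals Lra Psatz Classical IndefiniteDescription.
From Coquelicot Require Import Coquelicot.

(** By the Schwarz-Pick inequality [(1 - |z|^2) |phi' z| <= 1 - |phi z|^2], every
    self-map of the disc satisfies [||f o phi||_B <= ||f||_B] for the Bloch
    seminorm ([bloch_seminorm_composition_le]).  Along the orbit of [f] under the
    composition operator the seminorm therefore never exceeds [||f||_B].  The
    function [k z] has seminorm at least [|k|], so for [k = ||f||_B + 1] no point
    of the orbit is within distance 1 of it, and the orbit is not dense.

    The work goes into Schwarz-Pick ([schwarz_pick]) for functions that are only
    assumed complex differentiable at each point.  Two Moebius maps reduce it to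
    [|psi' 0| <= 1] for a self-map [psi] that fixes 0 ([schwarz_derivative_0]).
    For this, the mean of [Re (conj (psi' 0) * psi z / z)] over the circle
    [|z| = rho] does not depend on [rho] ([circle_mean_constant]): it tends to
    [|psi' 0|^2] as [rho] tends to 0, and is at most [|psi' 0| / rho].

    That the mean is constant is Cauchy's theorem on an annulus.  In logarithmic
    polar coordinates the annulus becomes a rectangle and the statement concerns a
    closed real 1-form; it is proved by Goursat's subdivision argument
    ([closed_form_circulation_0]), which needs no continuity of the derivatives. *)

Open Scope R_scope.

(** * Goursat's theorem for closed 1-forms on rectangles *)

Lemma nested_intervals_meet (x s : nat -> R) :
  (forall n, 0 <= s n) ->
  (forall n, x n <= x (S n) /\ x (S n) + s (S n) <= x n + s n) ->
  exists X, forall n, x n <= X <= x n + s n.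
Proof.
  intros Hs Hx.
  assert (low : forall n k, x n <= x (n + k)%nat).
  { intros n k; induction k as [|k IH]; [rewrite Nat.add_0_r; lra|].
    rewrite Nat.add_succ_r; specialize (Hx (n + k)%nat); lra. }
  assert (up : forall n k, x (n + k)%nat + s (n + k)%nat <= x n + s n).
  { intros n k; induction k as [|k IH]; [rewrite Nat.add_0_r; lra|].
    rewrite Nat.add_succ_r; specialize (Hx (n + k)%nat); lra. }
  assert (cross : forall n m, x m <= x n + s n).
  { intros n m; generalize (low m n) (up n m) (Hs (n + m)%nat).
    rewrite (Nat.add_comm m n); lra. }
  destruct (completeness (fun r => exists m, r = x m)) as [X [ub lub]].
  - exists (x 0%nat + s 0%nat); intros r [m ->]; apply cross.
  - now exists (x 0%nat), 0%nat.
  - exists X; intros n; split; [apply ub; now exists n|].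
    apply lub; intros r [m ->]; apply cross.
Qed.

(** Quartering a rectangle on which [P] fails yields nested rectangles of the
    same shape on which [P] fails; they shrink to a point, where [P] holds for
    all small rectangles.  This is the form of compactness that suits Goursat's
    argument: the rectangles near a point are compared with their own size, not
    with their distance to a fixed centre of a covering. *)
Lemma rectangle_induction (P : R -> R -> R -> R -> Prop) :
  (forall x y s t, 0 <= s -> 0 <= t ->
    P x y (s / 2) (t / 2) -> P (x + s / 2) y (s / 2) (t / 2) ->
    P x (y + t / 2) (s / 2) (t / 2) ->
    P (x + s / 2) (y + t / 2) (s / 2) (t / 2) ->
    P x y s t) ->
  forall x0 y0 s0 t0, 0 <= s0 -> 0 <= t0 ->
  (forall X Y, x0 <= X <= x0 + s0 -> y0 <= Y <= y0 + t0 ->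
    exists delta : posreal, forall x y s t,
      0 <= s < delta -> 0 <= t < delta ->
      x <= X <= x + s -> y <= Y <= y + t -> P x y s t) ->
  P x0 y0 s0 t0.
Proof.
  intros quarters x0 y0 s0 t0 Hs0 Ht0 small.
  apply NNPP; intros bad0.
  (* A rectangle is stored as its lower left corner and its two side lengths. *)
  set (step := fun r r' : (R * R) * (R * R) =>
    let '((x, y), (s, t)) := r in let '((x', y'), (s', t')) := r' in
    0 <= s -> 0 <= t -> ~ P x y s t ->
    ~ P x' y' s' t' /\ s' = s / 2 /\ t' = t / 2 /\
    (x <= x' <= x + s / 2) /\ (y <= y' <= y + t / 2)).
  destruct (functional_choice step) as [next Hnext].
  { intros [[x y] [s t]]; unfold step; cbn.
    destruct (classic (0 <= s /\ 0 <= t /\ ~ P x y s t)) as [[Hs [Ht bad]]|H].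
    2: exists ((x, y), (s, t)); tauto.
    destruct (classic (P x y (s / 2) (t / 2))) as [H1|H1].
    2: exists ((x, y), (s / 2, t / 2)); intros _ _ _; repeat split; (easy || lra).
    destruct (classic (P (x + s / 2) y (s / 2) (t / 2))) as [H2|H2].
    2: exists ((x + s / 2, y), (s / 2, t / 2)); intros _ _ _; repeat split; (easy || lra).
    destruct (classic (P x (y + t / 2) (s / 2) (t / 2))) as [H3|H3].
    2: exists ((x, y + t / 2), (s / 2, t / 2)); intros _ _ _; repeat split; (easy || lra).
    exists ((x + s / 2, y + t / 2), (s / 2, t / 2)); intros _ _ _.
    repeat split; try lra; intros H4; now apply bad, quarters. }
  set (rect := fun n => Nat.iter n next ((x0, y0), (s0, t0))).
  set (x := fun n => fst (fst (rect n))); set (y := fun n => snd (fst (rect n))).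
  set (s := fun n => fst (snd (rect n))); set (t := fun n => snd (snd (rect n))).
  assert (inv : forall n, 0 <= s n /\ 0 <= t n /\ ~ P (x n) (y n) (s n) (t n) /\
    s n = s0 / 2 ^ n /\ t n = t0 / 2 ^ n).
  { induction n as [|n IH].
    - unfold s, t, x, y; cbn; repeat split; (easy || lra).
    - generalize (Hnext (rect n)).
      change (next (rect n)) with (rect (S n)).
      revert IH; unfold s, t, x, y.
      destruct (rect n) as [[xn yn] [sn tn]],
        (rect (S n)) as [[xm ym] [sm tm]]; cbn [fst snd step].
      intros [Hs [Ht [bad [Es Et]]]] H.
      destruct (H Hs Ht bad) as [bad' [Es' [Et' _]]].
      repeat split; try lra; try easy;
        [rewrite Es', Es | rewrite Et', Et]; cbn; field; apply pow_nonzero; lra. }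
  assert (nest : forall n,
    (x n <= x (S n) <= x n + s n / 2 /\ s (S n) = s n / 2) /\
    (y n <= y (S n) <= y n + t n / 2 /\ t (S n) = t n / 2)).
  { intros n; generalize (Hnext (rect n)) (inv n).
    change (next (rect n)) with (rect (S n)); unfold s, t, x, y.
    destruct (rect n) as [[xn yn] [sn tn]],
      (rect (S n)) as [[xm ym] [sm tm]]; cbn [fst snd step]; intros H I.
    now destruct H as [_ H]. }
  destruct (nested_intervals_meet x s) as [X HX];
    [apply inv | intros n; generalize (nest n); lra|].
  destruct (nested_intervals_meet y t) as [Y HY];
    [apply inv | intros n; generalize (nest n); lra|].
  destruct (small X Y (HX 0%nat) (HY 0%nat)) as [delta Hd].
  assert (Hpos : 0 < delta / (s0 + t0 + 1)).
  { apply Rdiv_lt_0_compat; [apply cond_pos | lra]. }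
  destruct (pow_lt_1_zero (/ 2)) with (y := delta / (s0 + t0 + 1)) as [N HN];
    [rewrite Rabs_pos_eq; lra | easy |].
  specialize (HN N (le_n N)); rewrite pow_inv in HN.
  assert (H2 : 0 < / 2 ^ N) by (apply Rinv_0_lt_compat, pow_lt; lra).
  rewrite Rabs_pos_eq in HN by lra; apply Rlt_div_r in HN; [|lra].
  destruct (inv N) as [Hs [Ht [bad [Es Et]]]].
  apply bad, Hd; auto; split; trivial; [rewrite Es | rewrite Et];
    unfold Rdiv; nra.
Qed.

(** The integral of [u dx + p dy] along the boundary of [[a, b] x [c, d]].
    Opposite sides share an integral because their contributions nearly cancel:
    only differences of values of [u] and of [p] have to be estimated. *)
Definition circulation (u p : R -> R -> R) (a b c d : R) : R :=
  RInt (fun x => u x c - u x d) a b + RInt (fun y => p b y - p a y) c d.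

Lemma differentiable_continuous_fst f x y lx ly :
  differentiable_pt_lim f x y lx ly -> continuous (fun t => f t y) x.
Proof.
  intros H; apply continuity_pt_filterlim.
  apply derivable_continuous_pt; exists (lx * 1 + ly * 0).
  apply (derivable_pt_lim_comp_2d f (fun t => t) (fun _ => y));
    [exact H | apply derivable_pt_lim_id | apply derivable_pt_lim_const].
Qed.

Lemma differentiable_continuous_snd f x y lx ly :
  differentiable_pt_lim f x y lx ly -> continuous (fun t => f x t) y.
Proof.
  intros H; apply continuity_pt_filterlim.
  apply derivable_continuous_pt; exists (lx * 0 + ly * 1).
  apply (derivable_pt_lim_comp_2d f (fun _ => x) (fun t => t));
    [exact H | apply derivable_pt_lim_const | apply derivable_pt_lim_id].
Qed.

Lemma RInt_near_const (f : R -> R) a b k e : a <= b -> ex_RInt f a b ->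
  (forall x, a <= x <= b -> Rabs (f x - k) <= e) ->
  Rabs (RInt f a b - (b - a) * k) <= (b - a) * e.
Proof.
  intros ab Hf He.
  replace (RInt f a b - (b - a) * k) with (RInt (fun x => f x - k) a b).
  - apply abs_RInt_le_const; trivial.
    apply (ex_RInt_minus (V := R_NormedModule) f); trivial.
    apply (ex_RInt_const (V := R_NormedModule)).
  - rewrite (RInt_minus (V := R_CompleteNormedModule) f (fun _ => k)); trivial.
    + now rewrite (RInt_const (V := R_CompleteNormedModule)).
    + apply (ex_RInt_const (V := R_NormedModule)).
Qed.

(** The form [u dx + p dy] is closed when the y-derivative of [u] is the
    x-derivative of [p], here [r].  Continuity of the derivatives would make this
    Green's theorem; holomorphic functions are only known to be differentiable. *)
Section Goursat.

Variables (u p : R -> R -> R) (a b c d : R).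
Hypothesis closed_form : forall x y, a <= x <= b -> c <= y <= d ->
  exists ux r py, differentiable_pt_lim u x y ux r /\
                  differentiable_pt_lim p x y r py.

Local Lemma ex_RInt_row x1 x2 y : a <= x1 -> x1 <= x2 -> x2 <= b -> c <= y <= d ->
  ex_RInt (fun x => u x y) x1 x2.
Proof.
  intros H1 H12 H2 Hy; apply (ex_RInt_continuous (V := R_CompleteNormedModule)).
  rewrite Rmin_left, Rmax_right by easy; intros x Hx.
  destruct (closed_form x y) as [ux [r [py [D _]]]]; [lra | easy|].
  exact (differentiable_continuous_fst _ _ _ _ _ D).
Qed.

Local Lemma ex_RInt_column x y1 y2 : a <= x <= b -> c <= y1 -> y1 <= y2 -> y2 <= d ->
  ex_RInt (fun y => p x y) y1 y2.
Proof.
  intros Hx H1 H12 H2; apply (ex_RInt_continuous (V := R_CompleteNormedModule)).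
  rewrite Rmin_left, Rmax_right by easy; intros y Hy.
  destruct (closed_form x y) as [ux [r [py [_ D]]]]; [easy | lra|].
  exact (differentiable_continuous_snd _ _ _ _ _ D).
Qed.

Local Lemma ex_RInt_row_diff x1 x2 y1 y2 : a <= x1 -> x1 <= x2 -> x2 <= b ->
  c <= y1 <= d -> c <= y2 <= d ->
  ex_RInt (fun x => u x y1 - u x y2) x1 x2.
Proof.
  intros; apply (ex_RInt_minus (V := R_NormedModule)); now apply ex_RInt_row.
Qed.

Local Lemma ex_RInt_column_diff x1 x2 y1 y2 : c <= y1 -> y1 <= y2 -> y2 <= d ->
  a <= x1 <= b -> a <= x2 <= b ->
  ex_RInt (fun y => p x2 y - p x1 y) y1 y2.
Proof.
  intros; apply (ex_RInt_minus (V := R_NormedModule)); now apply ex_RInt_column.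
Qed.

Local Lemma circulation_split_fst x1 x2 x3 y1 y2 :
  a <= x1 -> x1 <= x2 -> x2 <= x3 -> x3 <= b ->
  c <= y1 -> y1 <= y2 -> y2 <= d ->
  circulation u p x1 x3 y1 y2
  = circulation u p x1 x2 y1 y2 + circulation u p x2 x3 y1 y2.
Proof.
  intros; unfold circulation.
  rewrite <- (RInt_Chasles (V := R_CompleteNormedModule)
    (fun x => u x y1 - u x y2) x1 x2 x3) by (apply ex_RInt_row_diff; lra).
  rewrite (RInt_ext (V := R_CompleteNormedModule) (fun y => p x3 y - p x1 y)
    (fun y => plus (p x2 y - p x1 y) (p x3 y - p x2 y)))
    by (intros; unfold plus; simpl; ring).
  rewrite (RInt_plus (V := R_CompleteNormedModule))
    by (apply ex_RInt_column_diff; lra).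
  unfold plus; simpl; ring.
Qed.

Local Lemma circulation_split_snd x1 x2 y1 y2 y3 :
  a <= x1 -> x1 <= x2 -> x2 <= b ->
  c <= y1 -> y1 <= y2 -> y2 <= y3 -> y3 <= d ->
  circulation u p x1 x2 y1 y3
  = circulation u p x1 x2 y1 y2 + circulation u p x1 x2 y2 y3.
Proof.
  intros; unfold circulation.
  rewrite <- (RInt_Chasles (V := R_CompleteNormedModule)
    (fun y => p x2 y - p x1 y) y1 y2 y3) by (apply ex_RInt_column_diff; lra).
  rewrite (RInt_ext (V := R_CompleteNormedModule) (fun x => u x y1 - u x y3)
    (fun x => plus (u x y1 - u x y2) (u x y2 - u x y3)))
    by (intros; unfold plus; simpl; ring).
  rewrite (RInt_plus (V := R_CompleteNormedModule))
    by (apply ex_RInt_row_diff; lra).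
  unfold plus; simpl; ring.
Qed.

(** Near [(X, Y)] the form is affine up to an error small against [s + t].  The
    affine closed form has circulation 0, since [u] varies by [- r * t] between
    the horizontal sides and [p] by [r * s] between the vertical ones; the error
    is integrated along a boundary of length [2 * (s + t)]. *)
Local Lemma circulation_small X Y (eps : posreal) :
  a <= X <= b -> c <= Y <= d ->
  exists delta : posreal, forall x y s t,
    0 <= s < delta -> 0 <= t < delta ->
    x <= X <= x + s -> y <= Y <= y + t ->
    a <= x -> x + s <= b -> c <= y -> y + t <= d ->
    Rabs (circulation u p x (x + s) y (y + t)) <= eps * (s + t) ^ 2.
Proof.
  intros HX HY; destruct (closed_form X Y HX HY) as [ux [r [py [Du Dp]]]].
  assert (He : 0 < eps / 2) by (generalize (cond_pos eps); lra).
  destruct (Du (mkposreal _ He)) as [d1 D1], (Dp (mkposreal _ He)) as [d2 D2].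
  assert (Hd : 0 < Rmin d1 d2) by (apply Rmin_glb_lt; apply cond_pos).
  exists (mkposreal _ Hd); cbn [pos] in *; intros x y s t Hs Ht Hx Hy ? ? ? ?.
  generalize (Rmin_l d1 d2) (Rmin_r d1 d2); intros m1 m2.
  assert (E : forall f fx fy (dd : posreal), Rmin d1 d2 <= dd ->
    (forall x' y', Rabs (x' - X) < dd -> Rabs (y' - Y) < dd ->
      Rabs (f x' y' - f X Y - (fx * (x' - X) + fy * (y' - Y)))
        <= eps / 2 * Rmax (Rabs (x' - X)) (Rabs (y' - Y))) ->
    forall x' y', x <= x' <= x + s -> y <= y' <= y + t ->
    Rabs (f x' y' - f X Y - (fx * (x' - X) + fy * (y' - Y))) <= eps / 2 * (s + t)).
  { intros f fx fy dd Hdd D x' y' Hx' Hy'.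
    eapply Rle_trans; [apply D; apply Rabs_lt_between; lra|].
    apply Rmult_le_compat_l; [lra|].
    apply Rmax_lub; apply Rabs_le_between; lra. }
  assert (Eu := E u ux r d1 m1 D1); assert (Ep := E p r py d2 m2 D2).
  assert (Iu := RInt_near_const (fun x' => u x' y - u x' (y + t)) x (x + s)
    (- (r * t)) (eps * (s + t)) ltac:(lra)
    ltac:(apply ex_RInt_row_diff; lra)).
  assert (Ip := RInt_near_const (fun y' => p (x + s) y' - p x y') y (y + t)
    (r * s) (eps * (s + t)) ltac:(lra)
    ltac:(apply ex_RInt_column_diff; lra)).
  unfold circulation.
  apply Rabs_le_between.
  assert (Ju : Rabs (RInt (fun x' => u x' y - u x' (y + t)) x (x + s)
    - (x + s - x) * (- (r * t))) <= (x + s - x) * (eps * (s + t))).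
  { apply Iu; intros x' Hx'.
    generalize (Eu x' y Hx' ltac:(lra)) (Eu x' (y + t) Hx' ltac:(lra)).
    intros A B; apply Rabs_le_between in A; apply Rabs_le_between in B.
    apply Rabs_le_between; lra. }
  assert (Jp : Rabs (RInt (fun y' => p (x + s) y' - p x y') y (y + t)
    - (y + t - y) * (r * s)) <= (y + t - y) * (eps * (s + t))).
  { apply Ip; intros y' Hy'.
    generalize (Ep x y' ltac:(lra) Hy') (Ep (x + s) y' ltac:(lra) Hy').
    intros A B; apply Rabs_le_between in A; apply Rabs_le_between in B.
    apply Rabs_le_between; lra. }
  apply Rabs_le_between in Ju; apply Rabs_le_between in Jp; lra.
Qed.

(** Goursat's theorem.  The bound [eps * (s + t) ^ 2] is inherited by a rectangle
    from its four quarters, because halving [s] and [t] divides it by 4, and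
    it holds for small rectangles; hence it holds for the whole, for each [eps]. *)
Lemma closed_form_circulation_0 : a <= b -> c <= d -> circulation u p a b c d = 0.
Proof.
  intros ab cd.
  assert (K : forall eps : posreal,
    Rabs (circulation u p a b c d) <= eps * (b - a + (d - c)) ^ 2).
  { intros eps.
    assert (Q := rectangle_induction (fun x y s t =>
      a <= x -> x + s <= b -> c <= y -> y + t <= d ->
      Rabs (circulation u p x (x + s) y (y + t)) <= eps * (s + t) ^ 2)).
    replace (circulation u p a b c d)
      with (circulation u p a (a + (b - a)) c (c + (d - c))) by (f_equal; ring).
    apply Q; try lra; clear Q.
    - intros x y s t Hs Ht Q1 Q2 Q3 Q4 ? ? ? ?.
      replace (x + s / 2 + s / 2) with (x + s) in * by lra.
      replace (y + t / 2 + t / 2) with (y + t) in * by lra.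
      rewrite (circulation_split_fst x (x + s / 2)) by lra.
      rewrite (circulation_split_snd x (x + s / 2) y (y + t / 2)) by lra.
      rewrite (circulation_split_snd (x + s / 2) (x + s) y (y + t / 2)) by lra.
      generalize (Q1 ltac:(lra) ltac:(lra) ltac:(lra) ltac:(lra))
        (Q2 ltac:(lra) ltac:(lra) ltac:(lra) ltac:(lra))
        (Q3 ltac:(lra) ltac:(lra) ltac:(lra) ltac:(lra))
        (Q4 ltac:(lra) ltac:(lra) ltac:(lra) ltac:(lra)).
      intros A B C' D.
      apply Rabs_le_between in A; apply Rabs_le_between in B.
      apply Rabs_le_between in C'; apply Rabs_le_between in D.
      apply Rabs_le_between; lra.
    - intros X Y HX HY; apply (circulation_small X Y eps); lra. }
  apply NNPP; intros H; apply Rabs_pos_lt in H.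
  set (S2 := (b - a + (d - c)) ^ 2) in K.
  assert (HS : 0 <= S2) by apply pow2_ge_0.
  assert (He : 0 < Rabs (circulation u p a b c d) / (2 * (S2 + 1))).
  { apply Rdiv_lt_0_compat; lra. }
  specialize (K (mkposreal _ He)); cbn [pos] in K.
  revert K; apply Rlt_not_le.
  set (J := Rabs (circulation u p a b c d)) in *.
  replace (J / (2 * (S2 + 1)) * S2) with (J / 2 * (S2 / (S2 + 1)))
    by (field; lra).
  assert (S2 / (S2 + 1) < 1) by (apply Rlt_div_l; lra).
  assert (0 <= S2 / (S2 + 1)) by (apply Rdiv_le_0_compat; lra).
  nra.
Qed.

End Goursat.

(** * Complex derivatives and Moebius maps *)

(** Derivatives in the algebra [C], where the product and chain rules are
    available.  [C_NormedModule] carries the same norm with other balls, so the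
    two notions of derivative agree but are not convertible. *)
Notation cderiv f z l :=
  (is_derive (K := C_AbsRing) (V := AbsRing_NormedModule C_AbsRing) f z l).

Lemma is_derive_C_iff (f : C -> C) (z l : C) :
  is_derive (K := C_AbsRing) (V := C_NormedModule) f z l <-> cderiv f z l.
Proof.
  split; intros [_ H]; split; try exact H.
  - apply (is_linear_scal_l (K := C_AbsRing) (V := AbsRing_NormedModule C_AbsRing)).
  - apply (is_linear_scal_l (K := C_AbsRing) (V := C_NormedModule)).
Qed.

Lemma cderiv_eps (f : C -> C) (z l : C) : cderiv f z l <->
  forall eps : posreal, exists delta : posreal, forall w,
    Cmod (w - z) < delta ->
    Cmod (f w - f z - (w - z) * l) <= eps * Cmod (w - z).
Proof.
  split.
  - intros [_ H] eps; destruct (H z (fun P h => h) eps) as [d Hd].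
    exists d; intros w Hw; exact (Hd w Hw).
  - intros H; split.
    + apply (is_linear_scal_l (K := C_AbsRing) (V := AbsRing_NormedModule C_AbsRing)).
    + intros x Hx eps.
      apply (is_filter_lim_locally_unique (K := C_AbsRing)
        (V := AbsRing_NormedModule C_AbsRing) z x) in Hx; subst x.
      destruct (H eps) as [d Hd]; exists d; intros w Hw; exact (Hd w Hw).
Qed.

Lemma cderiv_eq (f : C -> C) (z l l' : C) : cderiv f z l -> l = l' -> cderiv f z l'.
Proof. now intros D <-. Qed.

Lemma cderiv_mult (f g : C -> C) (z df dg : C) :
  cderiv f z df -> cderiv g z dg ->
  cderiv (fun w => f w * g w)%C z (df * g z + f z * dg)%C.
Proof. intros Hf Hg; exact (is_derive_mult f g z df dg Hf Hg Cmult_comm). Qed.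

Lemma cderiv_comp (f g : C -> C) (z df dg : C) :
  cderiv f (g z) df -> cderiv g z dg -> cderiv (fun w => f (g w)) z (dg * df)%C.
Proof. intros Hf Hg; exact (is_derive_comp (K := C_AbsRing)
  (V := AbsRing_NormedModule C_AbsRing) f g z df dg Hf Hg). Qed.

Lemma cderiv_quadratic (f : C -> C) (z l : C) (d : posreal) M :
  (forall w, Cmod (w - z) < d ->
    Cmod (f w - f z - (w - z) * l) <= M * Cmod (w - z) ^ 2) ->
  cderiv f z l.
Proof.
  intros H; apply cderiv_eps; intros eps.
  assert (He : 0 < Rmin d (eps / (Rabs M + 1))).
  { apply Rmin_glb_lt; [apply cond_pos|].
    apply Rdiv_lt_0_compat; [apply cond_pos|]; generalize (Rabs_pos M); lra. }
  exists (mkposreal _ He); cbn [pos]; intros w Hw.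
  generalize (Rmin_l d (eps / (Rabs M + 1))) (Rmin_r d (eps / (Rabs M + 1))).
  intros m1 m2; eapply Rle_trans; [apply H; lra|].
  assert (Hw' : Cmod (w - z) < eps / (Rabs M + 1)) by lra.
  apply Rlt_div_r in Hw'; [|generalize (Rabs_pos M); lra].
  generalize (Cmod_ge_0 (w - z)) (Rle_abs M); intros; nra.
Qed.

Lemma Cmod_triangle_minus (w z : C) : Cmod z - Cmod (w - z) <= Cmod w.
Proof.
  generalize (Cmod_triangle (w - (w - z))%C (w - z)%C) (Cmod_triangle w (- (w - z))%C).
  rewrite Cmod_opp; replace (w + - (w - z))%C with z by ring; lra.
Qed.

Lemma cderiv_inv (z : C) : z <> 0%C -> cderiv Cinv z (- / (z * z))%C.
Proof.
  intros Hz; assert (Pz := proj1 (Cmod_gt_0 z) Hz).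
  assert (Hd : 0 < Cmod z / 2) by lra.
  apply cderiv_quadratic with (d := mkposreal _ Hd) (M := 2 / Cmod z ^ 3).
  cbn [pos]; intros w Hw; generalize (Cmod_triangle_minus w z); intros T.
  assert (Pw : Cmod z / 2 < Cmod w) by lra.
  assert (Hw0 : w <> 0%C) by (apply Cmod_gt_0; lra).
  replace (/ w - / z - (w - z) * (- / (z * z)))%C
    with ((w - z) * (w - z) * / (w * (z * z)))%C by (field; auto).
  rewrite !Cmod_mult, Cmod_inv, !Cmod_mult.
  2: { apply Cmod_gt_0; rewrite !Cmod_mult; repeat apply Rmult_lt_0_compat; lra. }
  replace (Cmod (w - z) * Cmod (w - z)) with (Cmod (w - z) ^ 2) by ring.
  rewrite Rmult_comm; apply Rmult_le_compat_r; [apply pow2_ge_0|].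
  replace (2 / Cmod z ^ 3) with (/ (Cmod z / 2 * (Cmod z * Cmod z)))
    by (field; lra).
  apply Rinv_le_contravar; [repeat apply Rmult_lt_0_compat; lra|].
  apply Rmult_le_compat_r; nra.
Qed.

Lemma cderiv_affine (k l z : C) : cderiv (fun w => l + k * w)%C z k.
Proof.
  apply cderiv_quadratic with (d := mkposreal 1 Rlt_0_1) (M := 0); intros w _.
  replace (l + k * w - (l + k * z) - (w - z) * k)%C with (RtoC 0) by ring.
  rewrite Cmod_0; lra.
Qed.

(** For [b] in the disc, an automorphism of the disc that sends [b] to 0; its
    inverse is [mobius (- b)]. *)
Definition mobius (b z : C) : C := ((z - b) / (1 - Cconj b * z))%C.

Lemma mobius_denominator b z : Cmod b < 1 -> Cmod z < 1 -> (1 - Cconj b * z)%C <> 0%C.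
Proof.
  intros Hb Hz E.
  assert (H : (Cconj b * z)%C = RtoC 1).
  { replace (Cconj b * z)%C with (1 - (1 - Cconj b * z))%C by ring.
    rewrite E; ring. }
  apply (f_equal Cmod) in H; rewrite Cmod_mult, Cmod_conj, Cmod_1 in H.
  generalize (Cmod_ge_0 b) (Cmod_ge_0 z); nra.
Qed.

(** The square of the denominator minus that of the numerator is
    [(1 - |b|^2) (1 - |z|^2)]. *)
Lemma mobius_disc b z : in_disc b -> in_disc z -> in_disc (mobius b z).
Proof.
  unfold in_disc, mobius; intros Hb Hz.
  assert (D := mobius_denominator b z Hb Hz).
  rewrite Cmod_div by exact D.
  apply Cmod_gt_0 in D; apply Rlt_div_l; [exact D|]; rewrite Rmult_1_l.
  apply Rsqr_incrst_0; [|apply Cmod_ge_0..].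
  rewrite !Rsqr_pow2, !Cmod2_alt.
  assert (Hb2 : Cmod b ^ 2 < 1) by (generalize (Cmod_ge_0 b); nra).
  assert (Hz2 : Cmod z ^ 2 < 1) by (generalize (Cmod_ge_0 z); nra).
  rewrite Cmod2_alt in Hb2, Hz2; destruct b as [b1 b2], z as [z1 z2].
  cbn -[pow] in *; nra.
Qed.

Lemma cderiv_mobius b z : Cmod b < 1 -> Cmod z < 1 ->
  cderiv (mobius b) z ((1 - Cconj b * b) / (1 - Cconj b * z) ^ 2)%C.
Proof.
  intros Hb Hz; assert (D := mobius_denominator b z Hb Hz).
  assert (E : forall w, (1 + - Cconj b * w)%C = (1 - Cconj b * w)%C) by (intros; ring).
  assert (D' := D); rewrite <- E in D'.
  assert (H := cderiv_mult (fun w => - b + 1 * w)%C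
    (fun w => / (1 + - Cconj b * w))%C z _ _ (cderiv_affine 1 (- b) z)
    (cderiv_comp Cinv (fun w => 1 + - Cconj b * w)%C z _ _
      (cderiv_inv _ D') (cderiv_affine (- Cconj b) 1 z))).
  replace ((1 - Cconj b * b) / (1 - Cconj b * z) ^ 2)%C
    with (1 * / (1 + - Cconj b * z) + (- b + 1 * z) *
      (- Cconj b * - / ((1 + - Cconj b * z) * (1 + - Cconj b * z))))%C
    by (field; auto).
  apply is_derive_ext with (2 := H).
  intros w; unfold mobius; rewrite E; unfold Cdiv; f_equal; ring.
Qed.

(** * The mean over circles *)

Lemma cauchy_riemann (f : C -> C) (x y : R) (l : C) : cderiv f (x, y) l ->
  differentiable_pt_lim (fun u v => Re (f (u, v))) x y (Re l) (- Im l) /\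
  differentiable_pt_lim (fun u v => Im (f (u, v))) x y (Im l) (Re l).
Proof.
  intros D.
  assert (K : forall eps : posreal, locally_2d (fun u v =>
    Cmod (f (u, v) - f (x, y) - ((u, v) - (x, y)) * l)
      <= eps * Rmax (Rabs (u - x)) (Rabs (v - y))) x y).
  { intros eps.
    assert (He : 0 < eps / 2) by (generalize (cond_pos eps); lra).
    destruct (proj1 (cderiv_eps f (x, y) l) D (mkposreal _ He)) as [d Hd].
    assert (Hd2 : 0 < d / 2) by (generalize (cond_pos d); lra).
    exists (mkposreal _ Hd2); cbn [pos] in *; intros u v Hu Hv.
    assert (M : Cmod ((u, v) - (x, y)) <= 2 * Rmax (Rabs (u - x)) (Rabs (v - y))).
    { eapply Rle_trans; [apply Cmod_2Rmax|].
      apply Rmult_le_compat_r.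
      - eapply Rle_trans; [apply Rabs_pos | apply Rmax_l].
      - rewrite <- (sqrt_Rsqr 2) at 2 by lra; apply sqrt_le_1_alt; unfold Rsqr; lra. }
    eapply Rle_trans; [apply Hd|].
    - eapply Rle_lt_trans; [exact M|].
      generalize (Rmax_lub_lt _ _ _ Hu Hv); lra.
    - apply Rle_trans with (eps / 2 * (2 * Rmax (Rabs (u - x)) (Rabs (v - y))));
        [now apply Rmult_le_compat_l; [lra|] | lra]. }
  split; intros eps; destruct (K eps) as [d Hd]; exists d; intros u v Hu Hv;
    (eapply Rle_trans; [|exact (Hd u v Hu Hv)]).
  - eapply Rle_trans; [|apply Rabs_fst_le]; right; f_equal.
    destruct l, (f (u, v)), (f (x, y)); cbn; ring.
  - eapply Rle_trans; [|apply Rabs_snd_le]; right; f_equal.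
    destruct l, (f (u, v)), (f (x, y)); cbn; ring.
Qed.

Lemma differentiable_mult x y : differentiable_pt_lim Rmult x y y x.
Proof.
  intros eps; exists eps; intros u v Hu Hv.
  replace (u * v - x * y - (y * (u - x) + x * (v - y))) with ((u - x) * (v - y)) by ring.
  rewrite Rabs_mult; apply Rmult_le_compat; try apply Rabs_pos; [lra | apply Rmax_r].
Qed.

Lemma differentiable_snd f x y l :
  derivable_pt_lim f y l -> differentiable_pt_lim (fun _ v => f v) x y 0 l.
Proof.
  intros Hf.
  assert (P : differentiable_pt_lim (fun _ v => v) x y 0 1).
  { intros eps; exists eps; intros u v _ _.
    replace (v - y - (0 * (u - x) + 1 * (v - y))) with 0 by ring.
    rewrite Rabs_R0; apply Rmult_le_pos; [apply Rlt_le, cond_pos|].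
    eapply Rle_trans; [apply Rabs_pos | apply Rmax_l]. }
  replace 0 with (l * 0 + 0 * 0) by ring; replace l with (l * 1 + 0 * 1) at 2 by ring.
  exact (differentiable_pt_lim_comp (fun u _ => f u) (fun _ v => v) (fun _ v => v)
    x y l 0 0 1 0 1 (differentiable_pt_lim_proj1_0 f y y l Hf) P P).
Qed.

(** The exponential of [x + i y].  Taking the logarithm of the radius as first
    coordinate makes the map conformal, so that composing with it preserves the
    Cauchy-Riemann equations. *)
Definition polar (x y : R) : C := (exp x * cos y, exp x * sin y).

Lemma Cmod_polar x y : Cmod (polar x y) = exp x.
Proof.
  unfold Cmod, polar; cbn [fst snd].
  replace ((exp x * cos y) ^ 2 + (exp x * sin y) ^ 2) with (Rsqr (exp x)).
  - apply sqrt_Rsqr, Rlt_le, exp_pos.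
  - generalize (sin2_cos2 y); unfold Rsqr; nra.
Qed.

Lemma polar_2PI x : polar x (2 * PI) = polar x 0.
Proof. unfold polar; now rewrite cos_2PI, sin_2PI, cos_0, sin_0. Qed.

Lemma differentiable_pt_lim_eq f x y lx ly lx' ly' :
  differentiable_pt_lim f x y lx ly -> lx = lx' -> ly = ly' ->
  differentiable_pt_lim f x y lx' ly'.
Proof. now intros H <- <-. Qed.

Lemma polar_differentiable x y :
  differentiable_pt_lim (fun u v => exp u * cos v) x y (exp x * cos y) (- (exp x * sin y)) /\
  differentiable_pt_lim (fun u v => exp u * sin v) x y (exp x * sin y) (exp x * cos y).
Proof.
  assert (E := differentiable_pt_lim_proj1_0 exp x y _ (derivable_pt_lim_exp x)).
  split.
  - apply (differentiable_pt_lim_eq _ _ _ _ _ _ _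
      (differentiable_pt_lim_comp Rmult (fun u _ => exp u) (fun _ v => cos v)
        x y _ _ _ _ _ _ (differentiable_mult _ _) E
        (differentiable_snd cos x y _ (derivable_pt_lim_cos y)))); ring.
  - apply (differentiable_pt_lim_eq _ _ _ _ _ _ _
      (differentiable_pt_lim_comp Rmult (fun u _ => exp u) (fun _ v => sin v)
        x y _ _ _ _ _ _ (differentiable_mult _ _) E
        (differentiable_snd sin x y _ (derivable_pt_lim_sin y)))); ring.
Qed.

(** The form is [Im (f dz / z)] in the coordinates [z = polar x y], where
    [dz / z = dx + i dy]; it is closed by the Cauchy-Riemann equations. *)
Lemma polar_closed_form (f : C -> C) x y (l : C) : cderiv f (polar x y) l ->
  exists ux r py,
    differentiable_pt_lim (fun u v => Im (f (polar u v))) x y ux r /\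
    differentiable_pt_lim (fun u v => Re (f (polar u v))) x y r py.
Proof.
  intros D; destruct (cauchy_riemann f _ _ l D) as [DR DI].
  destruct (polar_differentiable x y) as [D1 D2].
  exists (Im l * (exp x * cos y) + Re l * (exp x * sin y)),
    (Re l * (exp x * cos y) + - Im l * (exp x * sin y)),
    (Re l * - (exp x * sin y) + - Im l * (exp x * cos y)); split.
  - apply (differentiable_pt_lim_eq _ _ _ _ _ _ _
      (differentiable_pt_lim_comp (fun u v => Im (f (u, v))) _ _ x y _ _ _ _ _ _
        DI D1 D2)); ring.
  - exact (differentiable_pt_lim_comp (fun u v => Re (f (u, v))) _ _ x y _ _ _ _ _ _
      DR D1 D2).
Qed.

Lemma ex_RInt_circle (f : C -> C) x :
  (forall z, Cmod z = exp x -> exists l, cderiv f z l) ->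
  ex_RInt (fun y => Re (f (polar x y))) 0 (2 * PI).
Proof.
  intros Hf; apply (ex_RInt_continuous (V := R_CompleteNormedModule)); intros y _.
  destruct (Hf (polar x y) (Cmod_polar x y)) as [l D].
  destruct (polar_closed_form f x y l D) as [ux [r [py [_ Dp]]]].
  exact (differentiable_continuous_snd _ _ _ _ _ Dp).
Qed.

(** In the rectangle [[a, b] x [0, 2 PI]] the two horizontal sides have the same
    image in the plane, so their contributions cancel. *)
Lemma circle_mean_constant (f : C -> C) a b : a <= b ->
  (forall z, exp a <= Cmod z <= exp b -> exists l, cderiv f z l) ->
  RInt (fun y => Re (f (polar a y))) 0 (2 * PI)
  = RInt (fun y => Re (f (polar b y))) 0 (2 * PI).
Proof.
  intros ab Hf.
  assert (HPI : 0 <= 2 * PI) by (generalize PI_RGT_0; lra).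
  assert (mono : forall x y, x <= y -> exp x <= exp y).
  { intros x y [H| ->]; [left; now apply exp_increasing | lra]. }
  assert (closed : forall x y, a <= x <= b -> 0 <= y <= 2 * PI -> exists ux r py,
    differentiable_pt_lim (fun u v => Im (f (polar u v))) x y ux r /\
    differentiable_pt_lim (fun u v => Re (f (polar u v))) x y r py).
  { intros x y Hx _; destruct (Hf (polar x y)) as [l D].
    - rewrite Cmod_polar; split; apply mono; lra.
    - exact (polar_closed_form f x y l D). }
  assert (J := closed_form_circulation_0 _ _ a b 0 (2 * PI) closed ab HPI).
  unfold circulation in J.
  rewrite (RInt_ext (V := R_CompleteNormedModule)
    (fun x => Im (f (polar x 0)) - Im (f (polar x (2 * PI)))) (fun _ => 0)) in J
    by (intros; rewrite polar_2PI; apply Rminus_diag).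
  rewrite (RInt_const (V := R_CompleteNormedModule)) in J.
  rewrite (RInt_minus (V := R_CompleteNormedModule)) in J
    by (apply ex_RInt_circle; intros z Hz; apply Hf; rewrite Hz; split; apply mono; lra).
  unfold minus, plus, opp, scal in J; simpl in J; unfold mult in J; simpl in J; lra.
Qed.

(** * The Schwarz-Pick inequality *)

Lemma cderiv_quotient_id (f : C -> C) (k z l : C) : z <> 0%C -> cderiv f z l ->
  exists l', cderiv (fun w => k * (f w / w))%C z l'.
Proof.
  intros Hz D; eexists.
  apply (cderiv_mult (fun _ => k)); [|apply (cderiv_mult f Cinv); [exact D|]].
  - apply (is_derive_const (K := C_AbsRing) (V := AbsRing_NormedModule C_AbsRing)).
  - now apply cderiv_inv.
Qed.

(** The function [conj l * psi z / z] tends to [|l|^2] at 0, while on the circle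
    of radius [rho] its modulus is at most [|l| / rho].  As its mean over circles is
    constant, [|l|^2 <= |l| / rho] for every [rho < 1]. *)
Lemma schwarz_derivative_0 (psi : C -> C) (l : C) :
  (forall z, Cmod z < 1 -> exists l', cderiv psi z l') ->
  (forall z, Cmod z < 1 -> Cmod (psi z) < 1) ->
  psi 0%C = 0%C -> cderiv psi (RtoC 0) l -> Cmod l <= 1.
Proof.
  intros Hd Hb H0 Dl; apply Rnot_lt_le; intros Hl.
  set (L := Cmod l) in *.
  set (f := fun z => (Cconj l * (psi z / z))%C).
  assert (Hf : forall z, 0 < Cmod z < 1 -> exists l', cderiv f z l').
  { intros z [Hz0 Hz]; destruct (Hd z Hz) as [m Dm].
    apply (cderiv_quotient_id _ _ _ m); [now apply Cmod_gt_0 | exact Dm]. }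
  assert (He : 0 < (L - 1) / 4) by lra.
  destruct (proj1 (cderiv_eps psi (RtoC 0) l) Dl (mkposreal _ He)) as [d Hd0].
  cbn [pos] in Hd0.
  (* The outer radius lies between [1 / L] and 1, so that [1 / rho] is the midpoint
     of 1 and [L]; the tolerance [(L - 1) / 4] fits in the gap from there to [L]. *)
  set (b := ln (2 / (1 + L))).
  assert (rho : exp b = 2 / (1 + L)).
  { apply exp_ln, Rdiv_lt_0_compat; lra. }
  assert (b1 : exp b < 1) by (rewrite rho; apply Rlt_div_l; lra).
  (* The inner radius [exp a], where [psi z / z] is within the tolerance of [l]. *)
  assert (Hab : exists a, a <= b /\ exp a < d).
  { exists (Rmin b (ln (d / 2))); split; [apply Rmin_l|].
    apply Rle_lt_trans with (exp (ln (d / 2))).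
    - destruct (Rmin_r b (ln (d / 2))) as [H|H];
        [left; now apply exp_increasing | rewrite H; lra].
    - rewrite exp_ln; generalize (cond_pos d); lra. }
  destruct Hab as [a [ab ad]].
  assert (HPI := PI_RGT_0).
  assert (ea : exp a <= exp b).
  { destruct ab as [H|H]; [left; now apply exp_increasing | rewrite H; lra]. }
  assert (Ea := exp_pos a).
  assert (mean := circle_mean_constant f a b ab
    ltac:(intros z Hz; apply Hf; lra)).
  assert (Ia := RInt_near_const (fun y => Re (f (polar a y))) 0 (2 * PI) (L ^ 2)
    (L * ((L - 1) / 4)) ltac:(lra)
    ltac:(apply ex_RInt_circle; intros z Hz; apply Hf; lra)).
  assert (Ib := RInt_near_const (fun y => Re (f (polar b y))) 0 (2 * PI) 0
    (L * ((1 + L) / 2)) ltac:(lra)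
    ltac:(apply ex_RInt_circle; intros z Hz; apply Hf; lra)).
  assert (Ja : Rabs (RInt (fun y => Re (f (polar a y))) 0 (2 * PI) - (2 * PI - 0) * L ^ 2)
    <= (2 * PI - 0) * (L * ((L - 1) / 4))).
  { apply Ia; intros y _.
    set (z := polar a y); assert (Ez : Cmod z = exp a) by apply Cmod_polar.
    assert (Hz : z <> 0%C) by (apply Cmod_gt_0; lra).
    replace (Re (f z) - L ^ 2) with (Re (Cconj l * ((psi z - 0 - (z - 0) * l) / z))%C).
    - eapply Rle_trans; [apply re_le_Cmod|].
      rewrite Cmod_mult, Cmod_conj, Cmod_div by exact Hz.
      apply Rmult_le_compat_l; [apply Cmod_ge_0|].
      apply Rle_div_l; [lra|].
      replace z with (z - 0)%C at 3 by ring; rewrite <- H0 at 1.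
      apply Hd0; replace (z - 0)%C with z by ring; lra.
    - replace (Cconj l * ((psi z - 0 - (z - 0) * l) / z))%C
        with (f z - l * Cconj l)%C by (unfold f; field; exact Hz).
      rewrite <- Cmod2_conj; fold L.
      unfold Cminus; rewrite re_plus, re_opp, re_RtoC; ring. }
  assert (Jb : Rabs (RInt (fun y => Re (f (polar b y))) 0 (2 * PI) - (2 * PI - 0) * 0)
    <= (2 * PI - 0) * (L * ((1 + L) / 2))).
  { apply Ib; intros y _.
    set (z := polar b y); assert (Ez : Cmod z = exp b) by apply Cmod_polar.
    assert (Hz : z <> 0%C) by (apply Cmod_gt_0; generalize (exp_pos b); lra).
    rewrite Rminus_0_r; eapply Rle_trans; [apply re_le_Cmod|].
    unfold f; rewrite Cmod_mult, Cmod_conj, Cmod_div by exact Hz.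
    apply Rmult_le_compat_l; [apply Cmod_ge_0|].
    rewrite Ez, rho; apply Rle_div_l; [rewrite <- rho; apply exp_pos|].
    replace ((1 + L) / 2 * (2 / (1 + L))) with 1 by (field; lra).
    apply Rlt_le, Hb; lra. }
  rewrite mean in Ja; apply Rabs_le_between in Ja; apply Rabs_le_between in Jb.
  assert (0 < L * ((L - 1) / 4)) by (apply Rmult_lt_0_compat; lra).
  nra.
Qed.

(** Conjugating by the automorphisms that move [z] and [phi z] to 0 reduces the
    inequality to [schwarz_derivative_0]. *)
Lemma schwarz_pick (phi : C -> C) (z l : C) : self_map_disc phi -> in_disc z ->
  is_derive (K := C_AbsRing) (V := C_NormedModule) phi z l ->
  (1 - Cmod z ^ 2) * Cmod l <= 1 - Cmod (phi z) ^ 2.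
Proof.
  unfold in_disc; intros [Hd Hm] Hz Dl; assert (Hp := Hm z Hz); unfold in_disc in Hp.
  set (b := phi z) in *.
  assert (Hz' : Cmod (- z) < 1) by now rewrite Cmod_opp.
  assert (E0 : mobius (- z) 0 = z) by (unfold mobius; field).
  assert (weight : forall w, (1 - Cconj w * w)%C = RtoC (1 - Cmod w ^ 2)).
  { intros w; rewrite RtoC_minus, Cmod2_conj; ring. }
  assert (pos : forall w, Cmod w < 1 -> 0 < 1 - Cmod w ^ 2).
  { intros w Hw; generalize (Cmod_ge_0 w); nra. }
  assert (D : forall w, Cmod w < 1 -> forall m, cderiv phi (mobius (- z) w) m ->
    cderiv (fun v => mobius b (phi (mobius (- z) v))) w
      ((1 - Cconj (- z) * - z) / (1 - Cconj (- z) * w) ^ 2 * m *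
       ((1 - Cconj b * b) / (1 - Cconj b * phi (mobius (- z) w)) ^ 2))%C).
  { intros w Hw m Dm; assert (Hw' := mobius_disc (- z) w Hz' Hw).
    apply (cderiv_comp (mobius b) (fun v => phi (mobius (- z) v))).
    - apply cderiv_mobius; [exact Hp | now apply Hm].
    - apply (cderiv_comp phi (mobius (- z))); [exact Dm | now apply cderiv_mobius]. }
  apply is_derive_C_iff in Dl.
  assert (K : Cmod ((1 - Cmod z ^ 2)%R * l * / (1 - Cmod b ^ 2)%R)%C <= 1).
  { apply (schwarz_derivative_0 (fun v => mobius b (phi (mobius (- z) v)))).
    - intros w Hw; destruct (Hd (mobius (- z) w) (mobius_disc _ _ Hz' Hw)) as [m Dm].
      apply is_derive_C_iff in Dm; eexists; exact (D w Hw m Dm).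
    - intros w Hw; apply mobius_disc; [exact Hp | now apply Hm, mobius_disc].
    - rewrite E0; fold b; unfold mobius, Cdiv; ring.
    - specialize (D 0%C ltac:(rewrite Cmod_0; lra) l); rewrite E0 in D.
      specialize (D Dl); fold b in D; rewrite !weight in D.
      rewrite Cmod_opp in D.
      apply (cderiv_eq _ _ _ _ D).
      field; intros E; apply (pos b) in Hp; apply RtoC_inj in E; lra. }
  apply pos in Hp; apply pos in Hz.
  rewrite !Cmod_mult, Cmod_inv, !Cmod_R, !Rabs_pos_eq in K;
    [|lra|lra|intros E; apply RtoC_inj in E; lra].
  apply (Rle_div_l _ 1) in K; lra.
Qed.

(** * Composition operators and the Bloch seminorm *)

Lemma locally_in_disc (z : C) : in_disc z ->
  locally (T := AbsRing_UniformSpace C_AbsRing) z in_disc.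
Proof.
  unfold in_disc; intros Hz; assert (Hd : 0 < 1 - Cmod z) by lra.
  exists (mkposreal _ Hd); intros w; change C in w; intros Hw.
  change (Cmod (w - z) < 1 - Cmod z) in Hw.
  generalize (Cmod_triangle (w - z) z); replace (w - z + z)%C with w by ring; lra.
Qed.

(** By Schwarz-Pick, the weight of [f o phi] at [z] is at most that of [f] at
    [phi z]. *)
Lemma bloch_seminorm_composition_le (phi : C -> C) (f g : little_bloch) :
  self_map_disc phi -> (forall z, in_disc z -> g z = f (phi z)) ->
  real (bloch_seminorm g) <= real (bloch_seminorm f).
Proof.
  intros phi_self E; assert (Bf := proj1 (lb_in f)).
  apply in_bloch_bound; [apply (proj1 (lb_in g))|].
  intros z Hz; assert (Hp := proj2 phi_self z Hz).
  apply Rle_trans with (bloch_weight f (phi z)); [|now apply bloch_seminorm_ub].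
  assert (Df := C_derive_correct f _ (RtoC 0) (proj1 Bf _ Hp)).
  assert (Dp := C_derive_correct phi _ (RtoC 0) (proj1 phi_self _ Hz)).
  assert (SP := schwarz_pick phi z _ phi_self Hz Dp).
  apply is_derive_C_iff in Df; apply is_derive_C_iff in Dp.
  assert (Dg : C_derive g z = (C_derive phi z * C_derive f (phi z))%C).
  { apply is_C_derive_unique, is_derive_C_iff.
    apply is_derive_ext_loc with (2 := cderiv_comp _ _ _ _ _ Df Dp).
    generalize (locally_in_disc z Hz); apply filter_imp; intros w Hw.
    symmetry; now apply E. }
  unfold bloch_weight; rewrite Dg, Cmod_mult, <- Rmult_assoc.
  apply Rmult_le_compat_r; [apply Cmod_ge_0 | exact SP].
Qed.

Lemma bloch_seminorm_iterate_le (phi : C -> C) (T : little_bloch -> little_bloch) f n :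
  self_map_disc phi -> is_composition_operator phi T ->
  real (bloch_seminorm (Nat.iter n T f)) <= real (bloch_seminorm f).
Proof.
  intros phi_self HT; induction n as [|n IH]; [apply Rle_refl|]; cbn [Nat.iter].
  eapply Rle_trans; [|exact IH].
  apply (bloch_seminorm_composition_le phi); [exact phi_self | apply HT].
Qed.

(** The value 0 off the disc is the one that [lb_off] requires. *)
Definition linear_on_disc (k : C) (z : C) : C :=
  if Rlt_dec (Cmod z) 1 then (k * z)%C else RtoC 0.

Lemma linear_on_disc_derive k z : in_disc z -> cderiv (linear_on_disc k) z k.
Proof.
  intros Hz; apply is_derive_ext_loc with (2 := cderiv_affine k 0 z).
  generalize (locally_in_disc z Hz); apply filter_imp; unfold in_disc; intros w Hw.
  unfold linear_on_disc; destruct (Rlt_dec (Cmod w) 1); [|easy].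
  match goal with |- ?x = ?y => change (@eq C x y) end; ring.
Qed.

Lemma linear_on_disc_weight k z : in_disc z ->
  bloch_weight (linear_on_disc k) z = (1 - Cmod z ^ 2) * Cmod k.
Proof.
  intros Hz; unfold bloch_weight; do 2 f_equal.
  now apply is_C_derive_unique, is_derive_C_iff, linear_on_disc_derive.
Qed.

Lemma linear_on_disc_little_bloch k : in_little_bloch (linear_on_disc k).
Proof.
  assert (Hk := Cmod_ge_0 k); split.
  - apply (in_bloch_bound _ (Cmod k)).
    + intros z Hz; exists k; now apply is_derive_C_iff, linear_on_disc_derive.
    + intros z Hz; rewrite linear_on_disc_weight by easy.
      generalize (pow2_ge_0 (Cmod z)); nra.
  - intros eps He; assert (Hm : 0 < eps / (2 * (Cmod k + 1))).
    { apply Rdiv_lt_0_compat; lra. }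
    set (m := eps / (2 * (Cmod k + 1))) in *.
    assert (Em : m * (2 * (Cmod k + 1)) = eps) by (unfold m; field; lra).
    exists (1 - m); split; [lra|]; intros z [Hz1 Hz2].
    rewrite linear_on_disc_weight by easy; assert (Hz := Cmod_ge_0 z).
    assert (0 <= 1 - Cmod z ^ 2 < 2 * m) by nra.
    rewrite Rabs_pos_eq; nra.
Qed.

Definition lb_linear (k : C) : little_bloch :=
  LittleBloch (linear_on_disc k) (linear_on_disc_little_bloch k)
    (fun z Hz => match Rlt_dec (Cmod z) 1 as s
       return (if s then (k * z)%C else RtoC 0) = RtoC 0 with
       | left h => False_ind _ (Hz h) | right _ => eq_refl end).

(** The seminorms of these functions are unbounded: the weight at 0 is [|k|]. *)
Lemma lb_linear_seminorm_ge k : Cmod k <= real (bloch_seminorm (lb_linear k)).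
Proof.
  generalize (bloch_seminorm_ub (lb_linear k) (RtoC 0) (proj1 (lb_in _)) in_disc0).
  cbn [lb_fun lb_linear]; rewrite linear_on_disc_weight by apply in_disc0.
  rewrite Cmod_0; lra.
Qed.

Lemma open_bloch_ball g r : open (bloch_ball g r).
Proof.
  intros h Hh; assert (Hd : 0 < r - bloch_norm (minus h g)).
  { unfold bloch_ball in Hh; lra. }
  exists (mkposreal _ Hd); intros h' Hh'.
  change (bloch_ball h (r - bloch_norm (minus h g)) h') in Hh'.
  unfold bloch_ball in *; rewrite (minus_trans h).
  eapply Rle_lt_trans; [apply bloch_norm_triangle|]; lra.
Qed.

Theorem theorem3p2 (phi : C -> C)
  (phi_self : self_map_disc phi)
  (phi_not_aut : ~ automorphism_disc phi)
  (phi_no_fixed : ~ exists z : C, in_disc z /\ phi z = z)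
  (C_phi : little_bloch -> little_bloch)
  (C_phi_comp : is_composition_operator phi C_phi)
  (C_phi_bounded : is_linear C_phi) :
  ~ hypercyclic C_phi.
Proof.
  intros [f orbit_dense].
  set (B := real (bloch_seminorm f)).
  assert (HB : 0 <= B) by apply bloch_seminorm_ge0, (proj1 (lb_in f)).
  set (g := lb_linear (RtoC (B + 1))).
  destruct (orbit_dense (bloch_ball g 1)) as [h [Hgh [n ->]]].
  - apply open_bloch_ball.
  - exists g; apply (bloch_ball_center g (mkposreal 1 Rlt_0_1)).
  - set (h := Nat.iter n C_phi f) in *.
    assert (Hh : real (bloch_seminorm h) <= B)
      by now apply (bloch_seminorm_iterate_le phi).
    assert (Hg : B + 1 <= real (bloch_seminorm g)).
    { eapply Rle_trans; [|apply lb_linear_seminorm_ge].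
      rewrite Cmod_R, Rabs_pos_eq; lra. }
    change (bloch_ball g 1 h) in Hgh.
    apply bloch_ball_sym in Hgh; unfold bloch_ball, bloch_norm in Hgh.
    assert (Hsum := proj2 (bloch_add (minus g h) h
      (proj1 (lb_in (minus g h))) (proj1 (lb_in h)))).
    change (fun w => Cplus (minus g h w) (h w))
      with (lb_fun (plus (minus g h) h)) in Hsum.
    unfold minus in Hsum at 1; rewrite <- plus_assoc, plus_opp_l, plus_zero_r in Hsum.
    generalize (Cmod_ge_0 (minus g h (RtoC 0))); lra.
Qed.
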